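(* Let $1\le p<\infty$, and assume that the sequences $\beta,\delta$ satisfy the standing assumption (stated in the context) for this $p$. Let $f\in\ell^p(\beta)$. Then $f$ is a cyclic vector for $M_{\diamond,z}$ in $\ell^p(\beta)$ if and only if $\hat f(0)\ne 0$.
   Context: Let $\{\beta(n)\}_{n\ge 0}$ and $\{\delta_n\}_{n\ge 0}$ be sequences of positive numbers with $\beta(0)=1$ and $\delta_0=1$; $\mathbb{N}=\{1,2,\dots\}$. For $1\le p<\infty$, $\ell^p(\beta)$ is the Banach space of complex sequences $f=\{\hat f(n)\}_{n\ge 0}$, written as formal power series $f(z)=\sum_{n\ge 0}\hat f(n)z^n$ (no convergence required), with $\|f\|_\beta^p=\sum_{n\ge 0}|\hat f(n)|^p\beta(n)^p<\infty$. The weighted Cauchy product is $f\diamond g=\sum_{n\ge 0}\sum_{m\ge 0}\frac{\delta_{n+m}}{\delta_n\delta_m}\hat f(n)\hat g(m)z^{n+m}$, and $M_{\diamond,z}(f)=z\diamond f=\sum_{n\ge 0}\frac{\delta_{n+1}}{\delta_n\delta_1}\hat f(n)z^{n+1}$, regarded as an operator on $\ell^p(\beta)$. A vector $x$ in a Banach space $X$ is cyclic for an operator $A$ on $X$ if the closed linear span of $\{A^nx:n=0,1,2,\dots\}$ is $X$. Standing assumption. If $1<p<\infty$, with conjugate exponent $q$: $\sup_{n\ge 0}\sum_{k=0}^{n}\left(\frac{\delta_n\beta(n)}{\delta_k\delta_{n-k}\beta(k)\beta(n-k)}\right)^{q}<\infty$, and for every integer $k\ge 1$, $b_{M,k}:=\sup_{n\ge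 M+1}\frac{\delta_{n+k}\beta(n+k)}{\delta_n\delta_k\beta(n)\beta(k)}$ satisfies $\lim_{M\to\infty}b_{M,k}=0$. If $p=1$: for some $N\in\mathbb{N}$, $\sum_{n,m\ge N+1}\frac{\delta_{n+m}\beta(n+m)}{\delta_n\delta_m\beta(n)\beta(m)}<\infty$.
   Formalization: For p=1 it is additionally assumed that M_{⋄,z} maps ℓ^1(β) into itself; the standing assumption does not imply this (e.g. δ=1, β(n)=exp(−n²−3(−1)^n n), N=3), and without it M_{⋄,z} is not an operator on ℓ^1(β). *)

(* Defs.v *)
From HB Require Import structures.
From mathcomp Require Import all_boot all_order all_algebra.
From mathcomp Require Import complex.
From mathcomp Require Import all_classical all_reals all_analysis.
Set Implicit Arguments.
Unset Strict Implicit.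
Unset Printing Implicit Defensive.
Import Order.TTheory GRing.Theory Num.Theory.
Import numFieldNormedType.Exports.
From mathcomp Require Import ring.
Import Normc.
Local Open Scope classical_set_scope.
Local Open Scope complex_scope.
Local Open Scope ring_scope.

Definition lin_span (K : numFieldType) (V : lmodType K) (S : set V) : set V :=
  [set v | exists (n : nat) (c : 'I_n -> K) (s : 'I_n -> V),
     (forall i, S (s i)) /\ v = \sum_(i < n) c i *: s i].

Definition cyclic_vector (K : numFieldType) (V : normedModType K)
    (A : {linear V -> V}) (x : V) : Prop :=
  closure (lin_span (range (fun n : nat => iter n A x))) = [set: V].

Section Sequences.
Context {R : realType}.
Implicit Types (p : R) (beta delta : nat -> R) (f g : nat -> R[i]).

(* The formal power series sum_n f n * z^n is identified with its coefficient
   sequence f. *)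
Definition ell_sum p beta f : \bar R :=
  (\sum_(n <oo) (normc (f n) `^ p * beta n `^ p)%:E)%E.

Definition in_ell p beta : {pred nat -> R[i]} :=
  fun f => (ell_sum p beta f < +oo)%E.

Definition weighted_prod delta f g : nat -> R[i] :=
  fun n => \sum_(k < n.+1)
    (delta n / (delta k * delta (n - k)%N))%:C * (f k * g (n - k)%N).

Definition zseq : nat -> R[i] := fun n => (n == 1)%:R.

Definition mul_z delta f : nat -> R[i] := weighted_prod delta zseq f.

Definition weight_ratio beta delta (n m : nat) : R :=
  (delta (n + m)%N * beta (n + m)%N) / (delta n * delta m * beta n * beta m).

Definition conj_exponent p : R := p / (p - 1).

Definition tail_bound beta delta (M k : nat) : \bar R :=
  ereal_sup [set (weight_ratio beta delta n k)%:E | n in [set n | (M.+1 <= n)%N]].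

Definition standing_assumption p beta delta : Prop :=
  (1 < p ->
     (ereal_sup (range (fun n : nat => (\sum_(k < n.+1)
        weight_ratio beta delta k (n - k)%N `^ conj_exponent p)%:E)) < +oo)%E
     /\ (forall k : nat, (1 <= k)%N ->
           (fun M => tail_bound beta delta M k) @ \oo --> 0%E)) /\
  (p = 1 ->
     exists2 N : nat, (1 <= N)%N &
       (\esum_(x in [set x : nat * nat | (N.+1 <= x.1)%N /\ (N.+1 <= x.2)%N])
          (weight_ratio beta delta x.1 x.2)%:E < +oo)%E).

End Sequences.

Lemma normc_abs (R : realType) (z : R[i]) : `|z| = (normc z)%:C.
Proof. by rewrite normc_def; case: z. Qed.

Lemma normc_nonneg (R : realType) (z : R[i]) : 0 <= normc z.
Proof. by case: z => a b; rewrite sqrtr_ge0. Qed.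

Lemma normcR (R : realType) (x : R) : normc x%:C = `|x|.
Proof. by rewrite /= expr0n addr0 sqrtr_sqr. Qed.

Lemma normc_triangle (R : realType) (z w : R[i]) :
  normc (z + w) <= normc z + normc w.
Proof. by have := ler_normD z w; rewrite !normc_abs -rmorphD lecR. Qed.

Section EllSpace.
Context {R : realType} {p : R} {beta : nat -> R}.
Variables (p_ge1 : 1 <= p) (beta_gt0 : forall n, 0 < beta n).
Implicit Types f g : nat -> R[i].

Let p_gt0 : 0 < p. Proof. exact: lt_le_trans p_ge1. Qed.

Definition ell_norm f : R := fine (ell_sum p beta f) `^ p^-1.

Let wmod f : nat -> R := fun n => normc (f n) * beta n.

Let wmod_ge0 f n : 0 <= wmod f n.
Proof. by rewrite mulr_ge0 ?normc_nonneg ?(ltW (beta_gt0 _)). Qed.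

Let wmodE f n : normc (f n) `^ p * beta n `^ p = wmod f n `^ p.
Proof. by rewrite /wmod powRM ?normc_nonneg ?(ltW (beta_gt0 _)). Qed.

Let term_ge0 f n : 0 <= normc (f n) `^ p * beta n `^ p.
Proof. by rewrite wmodE powR_ge0. Qed.

Let ell_sum_ge0 f : (0 <= ell_sum p beta f)%E.
Proof. by apply: nneseries_ge0 => n _ _; rewrite lee_fin. Qed.

Let LnormE f :
  Lnorm (@counting nat R) p%:E (EFin \o wmod f) = (ell_sum p beta f `^ p^-1)%E.
Proof.
rewrite Lnorm_counting//; congr (_ `^ _)%E; apply: eq_eseriesr => n _.
by rewrite wmodE/= ger0_norm.
Qed.

Let in_ellE f : (f \in in_ell p beta) = (ell_sum p beta f \is a fin_num).
Proof. by rewrite ge0_fin_numE. Qed.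

Let ell_normE f : f \in in_ell p beta ->
  (ell_norm f)%:E = Lnorm (@counting nat R) p%:E (EFin \o wmod f).
Proof. by rewrite in_ellE LnormE /ell_norm => h; rewrite -poweR_EFin fineK. Qed.

Let wmodD f g n : wmod (f + g) n <= wmod f n + wmod g n.
Proof. by rewrite /wmod -mulrDl ler_pM2r//; exact: normc_triangle. Qed.

Let ell_LnormD f g : (Lnorm (@counting nat R) p%:E (EFin \o wmod (f + g)%R) <=
  Lnorm (@counting nat R) p%:E (EFin \o wmod f) +
  Lnorm (@counting nat R) p%:E (EFin \o wmod g))%E.
Proof.
apply: le_trans (minkowski_EFin _ _ _ p_ge1) => //.
rewrite !Lnorm_counting//; apply: gt0_ler_poweR.
- by rewrite invr_ge0 ltW.
- by rewrite in_itv/= leey andbT; apply: nneseries_ge0 => n _ _; rewrite lee_fin powR_ge0.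
- by rewrite in_itv/= leey andbT; apply: nneseries_ge0 => n _ _; rewrite lee_fin powR_ge0.
apply: lee_nneseries => n _ /=; first by rewrite lee_fin powR_ge0.
rewrite lee_fin; apply: ge0_ler_powR; rewrite ?nnegrE ?(ltW p_gt0)//.
by rewrite !ger0_norm ?addr_ge0.
Qed.

Let in_ell_Lnorm f : (f \in in_ell p beta) =
  (Lnorm (@counting nat R) p%:E (EFin \o wmod f) < +oo)%E.
Proof.
rewrite LnormE; apply/idP/idP => [|/lty_poweRy]; first exact: poweR_lty.
by apply; rewrite invr_neq0// gt_eqF.
Qed.

Let ell_sumZ (a : R[i]) f :
  (ell_sum p beta (a *: f) = (normc a `^ p)%:E * ell_sum p beta f)%E.
Proof.
rewrite /ell_sum -nneseriesZl; last by move=> n _; rewrite lee_fin.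
apply: eq_eseriesr => n _; rewrite -EFinM; congr (_%:E).
by rewrite [(_ *: _) n]/(_ * _) normcM powRM ?mulrA ?normc_nonneg.
Qed.

Lemma in_ell_submod : submod_closed (in_ell p beta).
Proof.
split=> [|a f g].
  rewrite unfold_in /in_ell /ell_sum eseries0// => n _ _.
  by rewrite normc0 powR0 ?gt_eqF// mul0r.
move=> hf hg; rewrite in_ell_Lnorm; apply: le_lt_trans (ell_LnormD _ _) _.
apply: lte_add_pinfty; rewrite -in_ell_Lnorm; last exact: hg.
move: hf; rewrite !in_ellE ell_sumZ => hf.
by rewrite fin_numM.
Qed.

Lemma ell_norm_triangle f g : f \in in_ell p beta -> g \in in_ell p beta ->
  ell_norm (f + g) <= ell_norm f + ell_norm g.
Proof.
move=> hf hg; have [_ h] := in_ell_submod.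
have hfg : (f + g)%R \in in_ell p beta by have := h 1 f g hf hg; rewrite scale1r.
have := ell_LnormD f g.
by rewrite -(ell_normE hf) -(ell_normE hg) -(ell_normE hfg) -EFinD lee_fin.
Qed.

Lemma ell_normZ (a : R[i]) f : ell_norm (a *: f) = normc a * ell_norm f.
Proof.
rewrite /ell_norm ell_sumZ.
have [->|a0] := eqVneq (normc a) 0.
  by rewrite powR0 ?gt_eqF// mul0e/= powR0 ?mul0r// invr_neq0// gt_eqF.
have ac : (0 < normc a `^ p)%R by rewrite powR_gt0// lt0r a0 normc_nonneg.
have -> : fine ((normc a `^ p)%:E * ell_sum p beta f)%E =
          normc a `^ p * fine (ell_sum p beta f).
  by case: (ell_sum p beta f) (ell_sum_ge0 f) => [r| |]//= _; rewrite gt0_muley ?lte_fin// mulr0.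
rewrite powRM ?powR_ge0 ?fine_ge0// -powRrM divff ?gt_eqF// powRr1//.
exact: normc_nonneg.
Qed.

Lemma ell_norm_eq0 f : f \in in_ell p beta -> ell_norm f = 0 -> f = 0.
Proof.
rewrite in_ellE => hf /powR_eq0_eq0 h0.
have s0 : ell_sum p beta f = 0%E by rewrite -(fineK hf) h0.
apply/funext => n; apply: eq0_normc.
have : ((normc (f n) `^ p * beta n `^ p)%:E <= 0%:E)%E.
  rewrite -[leRHS]/(0%E) -s0 /ell_sum (nneseries_split_cond 0 n.+1); last first.
    by move=> k _; rewrite lee_fin.
  rewrite add0n big_mkord big_ord_recr/=.
  have A : (0 <= \sum_(i < n) (normc (f i) `^ p * beta i `^ p)%:E)%E.
    by apply: sume_ge0 => i _; rewrite lee_fin.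
  rewrite -addeA addeC -addeA leeDl// adde_ge0//.
  by apply: nneseries_ge0 => k _ _; rewrite lee_fin.
rewrite lee_fin wmodE => h.
have /powR_eq0_eq0 : wmod f n `^ p = 0 by apply/eqP; rewrite eq_le h powR_ge0.
by move/eqP; rewrite /wmod mulf_eq0 (gt_eqF (beta_gt0 n)) orbF => /eqP.
Qed.

End EllSpace.

(* The proofs p_ge1 and beta_gt0 are parameters of the type so that it can
   carry the normed-space structure, which depends on them. *)
Record ell (R : realType) (p : R) (beta : nat -> R) (p_ge1 : 1 <= p)
    (beta_gt0 : forall n, 0 < beta n) : Type := Ell {
  ell_val :> nat -> R[i];
  ell_valP : ell_val \in in_ell p beta }.

Section EllNormed.
Context {R : realType} {p : R} {beta : nat -> R}.
Variables (p_ge1 : 1 <= p) (beta_gt0 : forall n, 0 < beta n).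
Local Notation L := (ell p_ge1 beta_gt0).

HB.instance Definition _ := [isSub for @ell_val R p beta p_ge1 beta_gt0].
HB.instance Definition _ := [Choice of L by <:].
HB.instance Definition _ :=
  GRing.SubChoice_isSubLmodule.Build R[i] (nat -> R[i]) (in_ell p beta) L
    (in_ell_submod p_ge1 beta_gt0).

Let nrm (f : L) : R[i] := (@ell_norm R p beta f)%:C.

Let nrmD (f g : L) : nrm (f + g) <= nrm f + nrm g.
Proof.
by rewrite /nrm -rmorphD lecR; apply: ell_norm_triangle => //; exact: ell_valP.
Qed.

Let nrmZ (a : R[i]) (f : L) : nrm (a *: f) = `|a| * nrm f.
Proof. by rewrite /nrm normc_abs -rmorphM; congr (_%:C); exact: ell_normZ. Qed.

Let nrm_eq0 (f : L) : nrm f = 0 -> f = 0.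
Proof.
by case=> h; apply/val_inj; apply: ell_norm_eq0 h => //; exact: ell_valP.
Qed.

HB.instance Definition _ :=
  Lmodule_isNormed.Build R[i] L nrmD nrmZ nrm_eq0.

Lemma ell_normrE (f : L) : `|f| = (@ell_norm R p beta f)%:C.
Proof. by []. Qed.

End EllNormed.

Section Multiplication.
Context {R : realType} {p : R} {beta delta : nat -> R}.
Variables (p_ge1 : 1 <= p) (beta_gt0 : forall n, 0 < beta n)
  (delta_gt0 : forall n, 0 < delta n).

Lemma mul_z0 (f : nat -> R[i]) : mul_z delta f 0%N = 0.
Proof. by rewrite /mul_z /weighted_prod big_ord1 /zseq/= mul0r mulr0. Qed.

Lemma mul_zS (f : nat -> R[i]) n :
  mul_z delta f n.+1 = (delta n.+1 / (delta n * delta 1))%:C * f n.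
Proof.
rewrite /mul_z /weighted_prod 2!big_ord_recl /= big1 => [|i _].
  by rewrite /zseq/= mul0r mulr0 add0r addr0 mul1r subn1 /= (mulrC (delta n)).
by rewrite /zseq/= /bump/= mul0r mulr0.
Qed.

Hypothesis delta_beta : standing_assumption p beta delta.
(* For p = 1 the summability condition says nothing about the ratios with n = 1,
   and does not imply that multiplication by z preserves the space: take
   delta = 1 and beta n = exp (- n^2 - 3 (-1)^n n). *)
Hypothesis mul_z_ell1 :
  p = 1 -> forall f, f \in in_ell p beta -> mul_z delta f \in in_ell p beta.

Lemma in_ell_mul_z f : f \in in_ell p beta -> mul_z delta f \in in_ell p beta.
Proof.
have [p1|p1] := eqVneq p 1; first exact: mul_z_ell1.
have {}p1 : 1 < p by rewrite lt_neqAle eq_sym p1.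
have [/(_ p1)[+ _] _] := delta_beta.
set S := ereal_sup _ => Soo.
have q0 : 0 < conj_exponent p by rewrite divr_gt0 ?subr_gt0// (lt_trans _ p1).
have r_gt0 k n : 0 < weight_ratio beta delta k n.
  by rewrite /weight_ratio divr_gt0 ?mulr_gt0.
have rS k n : ((weight_ratio beta delta k n `^ conj_exponent p)%:E <= S)%E.
  apply: le_trans (ereal_sup_ubound _); last by exists (k + n)%N.
  have kn : (k < (k + n).+1)%N by rewrite ltnS leq_addr.
  rewrite lee_fin (bigD1 (Ordinal kn))//= addKn lerDl sumr_ge0// => i _.
  exact: powR_ge0.
have S0 : (0 <= S)%E by apply: le_trans (rS 0%N 0%N); rewrite lee_fin powR_ge0.
have Sfin : S \is a fin_num by rewrite ge0_fin_numE.
pose B := (fine S `^ (conj_exponent p)^-1 * beta 1) `^ p.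
have rB n : weight_ratio beta delta 1 n <= fine S `^ (conj_exponent p)^-1.
  rewrite -[leLHS]powRr1 ?(ltW (r_gt0 _ _))//.
  rewrite -(divff (lt0r_neq0 q0)) powRrM ge0_ler_powR ?invr_ge0 ?(ltW q0)//.
  - by rewrite nnegrE powR_ge0.
  - by rewrite nnegrE fine_ge0.
  by rewrite -lee_fin fineK.
rewrite !unfold_in /in_ell /ell_sum => hf.
have t0 g n : (0 <= (normc (g n) `^ p * beta n `^ p)%:E :> \bar R)%E.
  by rewrite lee_fin mulr_ge0 ?powR_ge0.
rewrite nneseries_recl// mul_z0 normc0 powR0 ?gt_eqF ?(lt_trans _ p1)//.
rewrite mul0r add0e.
rewrite (_ : (\sum_(1 <= k <oo) _)%E = (\sum_(k <oo)
    (normc (mul_z delta f k.+1) `^ p * beta k.+1 `^ p)%:E)%E); last first.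
  rewrite -(@nneseries_addn _ _ 1)//; apply: eq_eseriesr => n _; rewrite ?addn1 ?add1n//.
apply: (@le_lt_trans _ _ (\sum_(k <oo) B%:E *
    (normc (f k) `^ p * beta k `^ p)%:E)%E).
  apply: lee_nneseries => n _ //; rewrite lee_fin.
  have bg k := ltW (beta_gt0 k); have dg k := ltW (delta_gt0 k).
  have Mn : normc (mul_z delta f n.+1) * beta n.+1 =
      weight_ratio beta delta 1 n * (beta 1 * (normc (f n) * beta n)).
    rewrite mul_zS normcM normcR ger0_norm ?divr_ge0 ?mulr_ge0//.
    rewrite /weight_ratio add1n; field.
    by rewrite !gt_eqF.
  rewrite -!powRM ?normc_nonneg// -?powRM ?mulr_ge0 ?normc_nonneg ?powR_ge0//.
  rewrite Mn; apply: ge0_ler_powR; first by rewrite ltW// (lt_trans _ p1).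
  - rewrite nnegrE; apply: mulr_ge0; first exact: ltW.
    by rewrite !mulr_ge0 ?normc_nonneg.
  - by rewrite nnegrE !mulr_ge0 ?normc_nonneg ?powR_ge0.
  by rewrite -[leRHS]mulrA ler_wpM2r// !mulr_ge0 ?normc_nonneg.
rewrite nneseriesZl//.
have hfin : (\sum_(k <oo) (normc (f k) `^ p * beta k `^ p)%:E)%E \is a fin_num.
  by rewrite ge0_fin_numE ?nneseries_ge0.
by rewrite -(fineK hfin) -EFinM ltry.
Qed.

Definition mul_z_op (f : ell p_ge1 beta_gt0) : ell p_ge1 beta_gt0 :=
  Ell p_ge1 beta_gt0 (in_ell_mul_z (ell_valP f)).

Fact mul_z_op_is_linear : linear mul_z_op.
Proof.
move=> a f g; apply/val_inj/funext => k.
have h (u v : nat -> R[i]) : mul_z delta (fun n => a * u n + v n) k =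
    a * mul_z delta u k + mul_z delta v k.
  by case: k => [|k]; rewrite ?mul_z0 ?mul_zS; ring.
exact: h.
Qed.

HB.instance Definition _ := GRing.isLinear.Build R[i] _ _ _ mul_z_op
  mul_z_op_is_linear.

End Multiplication.

Arguments mul_z_op {R p beta delta} p_ge1 beta_gt0 delta_gt0 delta_beta
  mul_z_ell1 f.

(* Main.v *)
Require Import Defs.
From HB Require Import structures.
From mathcomp Require Import all_boot all_order all_algebra.
From mathcomp Require Import complex.
From mathcomp Require Import all_classical all_reals all_analysis.
From mathcomp Require Import ring lra.
Import Order.TTheory GRing.Theory Num.Theory.
Import numFieldNormedType.Exports.
Import Normc.
Local Open Scope classical_set_scope.
Local Open Scope complex_scope.
Local Open Scope ring_scope.

(** Put w n = delta n * beta n.  Dividing the coefficients of f by the delta's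
    turns the weighted product into the ordinary Cauchy product and the norm
    into a w-weighted l^p norm, so that the operator becomes, up to the factor
    1 / delta 1, multiplication by z; [weight_ratio n m] is
    w (n + m) / (w n * w m), the norm of z^(n+m) relative to those of z^n and
    z^m.  The coefficient functional f |-> f 0 is continuous and kills the
    range of the operator, so f 0 <> 0 is necessary.

    For sufficiency let V be the span of the orbit of f.  A triangular
    elimination gives, for every N, some F in V with F 0 = 1 and F k = 0 for
    0 < k <= N ([orbit_span_normalized]).  Write F = 1 + r.  The standing
    assumption says that for a suitable N and for M large enough, the product
    with r shrinks by one half the norm of the series that vanish to order M
    ([standing_assumption_small]).  Replacing such a series u by
    u - u F = - u r, after truncating u so that u F lies in V, then removes at
    least a quarter of the norm of u ([approx_step]); iterating shows that all
    series of order M are in the closure of V.  This is a Neumann series carried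
    out inside V.  Finally z^k = z^k F modulo series of order k + 1, so
    descending induction on the order of vanishing reaches all series
    ([approximable_all]).

    For p = 1 the shrinking comes from the ratios themselves: the terms of a
    convergent double series tend to 0.  The ratios with an index at most N
    need not be small, which is why r has to vanish to order N + 1.  For
    1 < p, r is cut into a polynomial, whose monomials act on high-order
    series with norm tending to 0 by the condition on the tail bounds, and a
    tail of small norm, to which the inequality
    |uv| <= C |u| |v| applies ([enorm_conv_le]).  That inequality is
    Hoelder's, with a constant C given by the supremum in the standing
    assumption, followed by the summation of a Cauchy product. *)

(** * Finite sums and small terms of summable families *)

Section FiniteSums.
Context {R : realType}.
Implicit Types (a c : nat -> R).

(** Hoelder's inequality, by summing Young's inequality for the normalised
    terms.  The norms are given by upper bounds A and B, so that one B can serve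
    for all lengths n. *)
Lemma hoelder_sum_le (p q A B : R) (n : nat) a c :
  0 < p -> 0 < q -> p^-1 + q^-1 = 1 -> 0 <= A -> 0 < B ->
  (forall i, 0 <= a i) -> (forall i, 0 <= c i) ->
  \sum_(i < n) a i `^ p <= A `^ p -> \sum_(i < n) c i `^ q <= B `^ q ->
  \sum_(i < n) a i * c i <= A * B.
Proof.
move=> p0 q0 pq A0 B0 a0 c0 aA cB.
have [Az|An] := eqVneq A 0.
  rewrite Az mul0r big1// => i _; move: aA.
  rewrite Az powR0 ?gt_eqF// (bigD1 i)//= => aA.
  have : a i `^ p <= 0.
    by apply: le_trans aA; rewrite lerDl sumr_ge0// => j _; exact: powR_ge0.
  move=> ai; have /powR_eq0_eq0 -> : a i `^ p = 0.
    by apply/eqP; rewrite eq_le ai powR_ge0.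
  by rewrite mul0r.
have {A0 An}A0 : 0 < A by rewrite lt_neqAle eq_sym An.
have Ap0 : 0 < A `^ p by exact: powR_gt0.
have Bq0 : 0 < B `^ q by exact: powR_gt0.
rewrite -[leRHS]mulr1 -mulrA -ler_pdivrMl// -ler_pdivrMl// !mulr_sumr.
apply: (@le_trans _ _ (\sum_(i < n)
    ((A `^ p)^-1 * a i `^ p / p + (B `^ q)^-1 * c i `^ q / q))).
  apply: ler_sum => i _.
  have -> : B^-1 * (A^-1 * (a i * c i)) = (A^-1 * a i) * (B^-1 * c i) by ring.
  have := @conjugate_powR _ (A^-1 * a i) (B^-1 * c i) p q.
  rewrite !powRM ?invr_ge0 ?(ltW A0) ?(ltW B0)//.
  have powV (x r : R) : 0 < x -> x^-1 `^ r = (x `^ r)^-1.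
    move=> x0; rewrite -(powR_inv1 (ltW x0)) -(powR_inv1 (powR_ge0 x r)).
    exact: powRAC.
  by rewrite !powV// => ->//; rewrite mulr_ge0// invr_ge0 ltW.
rewrite big_split/= -!mulr_suml -!mulr_sumr -pq lerD//.
  by rewrite -[leRHS]mul1r ler_wpM2r ?invr_ge0 ?(ltW p0)// ler_pdivrMl// mulr1.
by rewrite -[leRHS]mul1r ler_wpM2r ?invr_ge0 ?(ltW q0)// ler_pdivrMl// mulr1.
Qed.

(** The triangle of index pairs n + k < L lies in the square n, k < L. *)
Lemma sum_convolution_le a c (L : nat) :
  (forall i, 0 <= a i) -> (forall i, 0 <= c i) ->
  \sum_(m < L) \sum_(n < m.+1) a n * c (m - n)%N <=
  (\sum_(n < L) a n) * (\sum_(k < L) c k).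
Proof.
move=> a0 c0.
have -> : \sum_(m < L) \sum_(n < m.+1) a n * c (m - n)%N =
    \sum_(m < L) \sum_(n < L | (n < m.+1)%N) a n * c (m - n)%N.
  apply: eq_bigr => m _.
  by rewrite (big_ord_widen L (fun n => a n * c (m - n)%N)).
rewrite (exchange_big_dep predT)//= mulr_suml; apply: ler_sum => n _.
rewrite -mulr_sumr ler_wpM2l//.
rewrite -(big_mkord (fun m => (n < m.+1)%N) (fun m => c (m - n)%N)).
rewrite -(big_mkord predT c).
rewrite (big_cat_nat (n := n))//=; last exact: ltnW.
rewrite big_nat_cond big1 ?add0r; last first.
  by move=> i /andP[/andP[_ lt_in]]; rewrite ltnS leqNgt lt_in.
rewrite -{1}[nat_of_ord n]add0n big_addn.
rewrite [leRHS](big_cat_nat (n := (L - n)%N))//= ?leq_subr//.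
rewrite big_mkcond/= [leLHS](_ : _ = \sum_(0 <= i < L - n) c i).
  by rewrite lerDl sumr_ge0.
by apply: eq_bigr => i _; rewrite ltnS leq_addl addnK.
Qed.

Lemma sum_ord_le_support a (D m : nat) :
  (forall i, 0 <= a i) -> (forall i, (m < i)%N -> a i = 0) ->
  \sum_(i < D) a i <= \sum_(i < m.+1) a i.
Proof.
move=> a0 am; apply: (@le_trans _ _ (\sum_(i < m.+1 + D) a i)).
  by rewrite addnC big_split_ord/= lerDl sumr_ge0.
rewrite big_split_ord/= [X in _ + X]big1 ?addr0// => i _.
by rewrite am//= addSn ltnS leq_addr.
Qed.

End FiniteSums.

(** Take for Y a finite set whose partial sum is within e of the total. *)
Lemma esum_fin_small {R : realType} {T : choiceType} (I : set T) (a : T -> R)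
    (e : R) :
  (forall x, 0 <= a x) -> (\esum_(x in I) (a x)%:E < +oo)%E -> 0 < e ->
  exists2 Y, finite_set Y & forall x, I x -> ~ Y x -> a x <= e.
Proof.
move=> a0 aoo e0; set S := (\esum_(x in I) (a x)%:E)%E in aoo.
have ae0 x : (0 <= (a x)%:E :> \bar R)%E by rewrite lee_fin.
have Sfin : S \is a fin_num by rewrite ge0_fin_numE ?esum_ge0.
have : (S - e%:E < S)%E by rewrite lteBlDr// lteDl.
move=> /ereal_sup_gt[_ [Y [finY YI] <-]] SY; exists Y => // x Ix nYx.
have : (\sum_(y \in Y) (a y)%:E + (a x)%:E <= S)%E.
  rewrite /S (esumID Y)//; apply: leeD.
    by rewrite (_ : I `&` Y = Y) ?esum_fset//; exact/setIidPr.
  apply: esum_ge; exists [set x]; last by rewrite fsbig_set1.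
  by split=> [|_ ->]; [exact: finite_set1|split].
move=> /(lt_le_trans _)-/(_ _ (lte_leD _ SY (lexx (a x)%:E))) /=.
rewrite -(fineK Sfin) => /(_ isT).
by rewrite -EFinB -EFinD lte_fin addrAC -addrA gtrDl subr_lt0 => /ltW.
Qed.

Lemma cvge0_le {R : realType} (h : nat -> \bar R) (e : R) :
  h n @[n --> \oo] --> 0%E -> 0 < e -> exists n, (h n <= e%:E)%E.
Proof.
move=> /fine_cvgP[fin /cvgrPdist_lt clo] e0; near \oo => n; exists n.
have fn : h n \is a fin_num by near: n.
rewrite -(fineK fn) lee_fin; apply: ltW.
suff : `|0 - fine (h n)| < e.
  by rewrite sub0r normrN; apply: le_lt_trans; exact: ler_norm.
by near: n; exact: clo.
Unshelve. all: by end_near.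
Qed.

(** * Norms, coefficients and truncations *)

Definition wabs {R : realType} (beta : nat -> R) (h : nat -> R[i])
    (n : nat) : R :=
  normc (h n) * beta n.

Section EllTheory.
Context {R : realType} {p : R} {beta : nat -> R}.
Context {p_ge1 : 1 <= p} {beta_gt0 : forall n, 0 < beta n}.
Local Notation L := (ell p_ge1 beta_gt0).
Local Notation wt := (wabs beta).
Implicit Types (f g u : L) (h : nat -> R[i]).

Definition enorm f : R := @ell_norm R p beta f.

Let p_gt0 : 0 < p. Proof. exact: lt_le_trans p_ge1. Qed.

Lemma wabs_ge0 h n : 0 <= wt h n.
Proof. by rewrite mulr_ge0 ?normc_nonneg ?ltW. Qed.

Lemma ell_sumE h : ell_sum p beta h = (\sum_(n <oo) (wt h n `^ p)%:E)%E.
Proof.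
by apply: eq_eseriesr => n _; rewrite powRM ?normc_nonneg ?ltW.
Qed.

Lemma ell_sum_le h (B : R) :
  (forall D, \sum_(n < D) wt h n `^ p <= B) -> (ell_sum p beta h <= B%:E)%E.
Proof.
move=> hB; rewrite ell_sumE; apply: lime_le.
  by apply: is_cvg_nneseries => n _ _; rewrite lee_fin powR_ge0.
by apply: nearW => D; rewrite big_mkord sumEFin lee_fin.
Qed.

Lemma enorm_ge0 f : 0 <= enorm f.
Proof. exact: powR_ge0. Qed.

Lemma enorm_le f (B : R) : 0 <= B ->
  (forall D, \sum_(n < D) wt f n `^ p <= B `^ p) -> enorm f <= B.
Proof.
move=> B0 /ell_sum_le fB.
have s0 : (0 <= ell_sum p beta f)%E.
  by rewrite ell_sumE; apply: nneseries_ge0 => n _ _; rewrite lee_fin powR_ge0.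
rewrite -[leRHS]powRr1// -[in leRHS](divff (lt0r_neq0 p_gt0)) powRrM.
apply: ge0_ler_powR; rewrite ?nnegrE ?powR_ge0 ?invr_ge0 ?fine_ge0//.
  exact: ltW.
by rewrite -lee_fin fineK// ge0_fin_numE// (le_lt_trans fB)// ltry.
Qed.

Lemma sum_wabs_le_enorm f D :
  \sum_(n < D) wt f n `^ p <= enorm f `^ p.
Proof.
have s0 : (0 <= ell_sum p beta f)%E.
  by rewrite ell_sumE; apply: nneseries_ge0 => n _ _; rewrite lee_fin powR_ge0.
rewrite /enorm /ell_norm -powRrM mulVf ?gt_eqF// powRr1 ?fine_ge0//.
rewrite -lee_fin fineK; last first.
  by rewrite ge0_fin_numE//; exact: (ell_valP f).
rewrite ell_sumE -sumEFin -(big_mkord predT (fun n => (wt f n `^ p)%:E)).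
by apply: nneseries_lim_ge => n _ _; rewrite lee_fin powR_ge0.
Qed.

Lemma wabs_le_enorm f n : wt f n <= enorm f.
Proof.
have := sum_wabs_le_enorm f n.+1; rewrite big_ord_recr/= => h.
rewrite leNgt; apply/negP => lt_fn.
have : enorm f `^ p < wt f n `^ p.
  by apply: gt0_ltr_powR; rewrite ?nnegrE ?enorm_ge0 ?wabs_ge0.
rewrite ltNge (le_trans _ h)// lerDr sumr_ge0// => i _; exact: powR_ge0.
Qed.

Lemma enorm0 : enorm (0 : L) = 0.
Proof.
apply/eqP; rewrite eq_le enorm_ge0 andbT; apply: enorm_le => // D.
rewrite big1 ?powR_ge0// => n _.
by rewrite /wabs normc0 mul0r powR0 ?gt_eqF.
Qed.

Lemma enormD f g : enorm (f + g) <= enorm f + enorm g.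
Proof. by apply: ell_norm_triangle => //; exact: ell_valP. Qed.

Lemma enormZ (a : R[i]) f : enorm (a *: f) = normc a * enorm f.
Proof. exact: ell_normZ. Qed.

Lemma enormN f : enorm (- f) = enorm f.
Proof. by rewrite -scaleN1r enormZ normcN normc1 mul1r. Qed.

Lemma enormB f g : enorm (f - g) <= enorm f + enorm g.
Proof. by rewrite -(enormN g); exact: enormD. Qed.

Lemma enorm_sum (I : Type) (s : seq I) (F : I -> L) :
  enorm (\sum_(i <- s) F i) <= \sum_(i <- s) enorm (F i).
Proof.
elim: s => [|i s IH]; first by rewrite !big_nil enorm0.
by rewrite !big_cons (le_trans (enormD _ _))// lerD2l.
Qed.

Lemma enorm_sumZ D (c : nat -> R[i]) (F : nat -> L) :
  enorm (\sum_(i < D) c i *: F i) <= \sum_(i < D) normc (c i) * enorm (F i).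
Proof.
by apply: le_trans (enorm_sum _ _ _) _; under eq_bigr do rewrite enormZ.
Qed.

Lemma ell_eqP f g : (forall n, f n = g n) -> f = g.
Proof. by move=> fg; apply/val_inj/funext. Qed.

Lemma coefD f g n : (f + g) n = f n + g n. Proof. by []. Qed.
Lemma coefB f g n : (f - g) n = f n - g n. Proof. by []. Qed.
Lemma coefZ (a : R[i]) f n : (a *: f) n = a * f n. Proof. by []. Qed.
Lemma coef_sum (I : Type) (s : seq I) (F : I -> L) n :
  (\sum_(i <- s) F i) n = \sum_(i <- s) F i n.
Proof. by elim: s => [|i s IH]; rewrite ?big_nil// !big_cons coefD IH. Qed.

Lemma mono_subproof (n : nat) : (fun m => (m == n)%:R : R[i]) \in in_ell p beta.
Proof.
rewrite unfold_in; apply: le_lt_trans (ltry (beta n `^ p)).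
apply: ell_sum_le => D.
have w0 m : m != n -> wt (fun m => (m == n)%:R) m `^ p = 0.
  by move=> /negPf mn; rewrite /wabs mn normc0 mul0r powR0 ?gt_eqF.
apply: (le_trans (sum_ord_le_support (fun m => wt _ m `^ p) D n _ _)).
- by move=> i; exact: powR_ge0.
- by move=> i ni; rewrite w0// gtn_eqF.
rewrite (bigD1 ord_max)//= big1 ?addr0; last first.
  by move=> i; rewrite -val_eqE/= => ni; rewrite w0.
by rewrite /wabs eqxx normc1 mul1r.
Qed.

Definition mono (n : nat) : L := Ell p_ge1 beta_gt0 (mono_subproof n).

Lemma coef_mono (n m : nat) : mono n m = (m == n)%:R. Proof. by []. Qed.

Definition trunc D f : L := \sum_(n < D) f n *: mono n.

Lemma coef_trunc D f m : trunc D f m = if (m < D)%N then f m else 0.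
Proof.
rewrite coef_sum; case: ifPn => mD.
  rewrite (bigD1 (Ordinal mD))// coefZ coef_mono eqxx mulr1.
  rewrite big1 => [|i /eqP im].
    by rewrite /= addr0.
  rewrite coefZ coef_mono; case: eqP => [mi|_]; last by rewrite mulr0.
  by case: im; exact/val_inj.
rewrite big1// => i _; rewrite coefZ coef_mono.
by case: eqP => [mi|_]; rewrite ?mulr0//; rewrite mi ltn_ord in mD.
Qed.

Lemma enorm_trunc D f : enorm (trunc D f) <= enorm f.
Proof.
apply: enorm_le => [|n]; first exact: enorm_ge0.
apply: le_trans (sum_wabs_le_enorm f n); apply: ler_sum => i _.
rewrite /wabs coef_trunc; case: ifP => // _.
by rewrite normc0 mul0r powR0 ?powR_ge0 ?gt_eqF.
Qed.

Lemma trunc_approx f (e : R) : 0 < e -> exists D, enorm (f - trunc D f) <= e.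
Proof.
move=> e0.
have := @nneseries_tail_cvg R (fun n => (wt f n `^ p)%:E) xpredT.
rewrite -ell_sumE => /(_ (ell_valP f)) h.
have tail0 := h (fun k _ => powR_ge0 (wt f k) p).
have [D hD] := cvge0_le _ _ tail0 (powR_gt0 p e0).
exists D; move: (f - trunc D f)
  (fun i => coefB f (trunc D f) i) => g gE.
apply: enorm_le => [|n]; first exact: ltW.
have s0 k : (0 <= (wt f k `^ p)%:E :> \bar R)%E by rewrite lee_fin powR_ge0.
rewrite -lee_fin; apply: le_trans hD.
apply: (@le_trans _ _ (\sum_(D <= k < D + n) (wt f k `^ p)%:E)%E); last first.
  by apply: nneseries_lim_ge => k _ _.
rewrite sumEFin lee_fin -(big_mkord predT (fun i => wt g i `^ p)).
apply: (@le_trans _ _ (\sum_(0 <= i < D + n) wt g i `^ p)).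
  rewrite [leRHS](big_cat_nat (n := n))//= ?leq_addl//.
  by rewrite lerDl sumr_ge0// => i _; exact: powR_ge0.
rewrite (big_cat_nat (n := D))//= ?leq_addr//.
rewrite big_nat_cond big1 ?add0r; last first.
  move=> i /andP[/andP[_ iD] _].
  by rewrite /wabs gE coef_trunc iD subrr normc0 mul0r powR0 ?gt_eqF.
rewrite big_nat_cond [leRHS]big_nat_cond.
apply: ler_sum => i /andP[/andP[Di _] _].
by rewrite /wabs gE coef_trunc ltnNge Di subr0.
Qed.

End EllTheory.

(** * Multiplication by powers of z *)

Section WeightedShift.
Context {R : realType} {p : R} {beta delta : nat -> R}.
Context {p_ge1 : 1 <= p} {beta_gt0 : forall n, 0 < beta n}.
Local Notation L := (ell p_ge1 beta_gt0).
Context {A : {linear L -> L}}.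
Hypothesis delta_gt0 : forall n, 0 < delta n.
Hypothesis AE : forall (f : L) n, A f n = mul_z delta f n.
Implicit Types (f g u r : L).
Local Notation ratio := (weight_ratio beta delta).
Local Notation wt := (wabs beta).
Local Notation enorm := (@enorm R p beta p_ge1 beta_gt0).
Local Notation mono := (@mono R p beta p_ge1 beta_gt0).

Let p_gt0 : 0 < p. Proof. exact: lt_le_trans p_ge1. Qed.

Lemma coef_iter_lt n f m : (m < n)%N -> iter n A f m = 0.
Proof.
elim: n m => // n IH [|m] mn; rewrite iterS AE; first exact: mul_z0.
by rewrite mul_zS IH// mulr0.
Qed.

Lemma coef_iter_add n f k :
  iter n A f (n + k)%N = (delta (n + k)%N / (delta k * delta 1 ^+ n))%:C * f k.
Proof.
elim: n => [|n IH].
  by rewrite /= add0n expr0 mulr1 divff ?gt_eqF// mul1r.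
rewrite iterS addSn AE mul_zS IH mulrA -rmorphM; congr (_%:C * _).
rewrite exprS; field.
by rewrite !gt_eqF ?exprn_gt0.
Qed.

(** The weighted product of z^n with f: the n-th power of z for the weighted
    product is (delta n / delta 1 ^+ n) z^n. *)
Definition zmul n f : L := (delta 1 ^+ n / delta n)%:C *: iter n A f.

Lemma coef_zmul_lt n f m : (m < n)%N -> zmul n f m = 0.
Proof. by move=> mn; rewrite coefZ coef_iter_lt ?mulr0. Qed.

Lemma coef_zmul_add n f k :
  zmul n f (n + k)%N = (delta (n + k)%N / (delta n * delta k))%:C * f k.
Proof.
rewrite coefZ coef_iter_add mulrA -rmorphM; congr (_%:C * _); field.
by rewrite !gt_eqF ?exprn_gt0.
Qed.

Variant zmul_index_spec n : nat -> Type :=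
  | ZmulLt m of (m < n)%N : zmul_index_spec n m
  | ZmulAdd k : zmul_index_spec n (n + k)%N.

Lemma zmul_indexP n m : zmul_index_spec n m.
Proof.
by have [mn|/subnKC <-] := ltnP m n; [exact: ZmulLt|exact: ZmulAdd].
Qed.

Lemma zmulD n f g : zmul n (f + g) = zmul n f + zmul n g.
Proof.
apply: ell_eqP => m; rewrite coefD; case: (zmul_indexP n m) => [{}m mn|k].
  by rewrite !coef_zmul_lt// addr0.
by rewrite !coef_zmul_add coefD mulrDr.
Qed.

Lemma zmulZ n (a : R[i]) f : zmul n (a *: f) = a *: zmul n f.
Proof.
apply: ell_eqP => m; rewrite coefZ; case: (zmul_indexP n m) => [{}m mn|k].
  by rewrite !coef_zmul_lt// mulr0.
by rewrite !coef_zmul_add coefZ mulrCA.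
Qed.

Lemma zmul_sumZ n D (c : nat -> R[i]) (F : nat -> L) :
  zmul n (\sum_(i < D) c i *: F i) = \sum_(i < D) c i *: zmul n (F i).
Proof.
elim: D => [|D IH]; last by rewrite !big_ord_recr/= zmulD IH zmulZ.
by rewrite !big_ord0 -(scale0r (0 : L)) zmulZ !scale0r.
Qed.

Lemma zmul_monoC (n k : nat) : zmul n (mono k) = zmul k (mono n).
Proof.
suff H (i j m : nat) : zmul i (mono j) m =
    (delta (i + j)%N / (delta i * delta j))%:C * (m == i + j)%N%:R.
  by apply: ell_eqP => m; rewrite !H addnC (mulrC (delta n)).
case: (zmul_indexP i m) => [{}m mi|l].
  rewrite coef_zmul_lt// (_ : (m == i + j)%N = false) ?mulr0//.
  by apply/negbTE; rewrite neq_ltn (leq_trans mi)// leq_addr.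
rewrite coef_zmul_add coef_mono eqn_add2l; case: eqP => [->//|_].
by rewrite !mulr0.
Qed.

Lemma ratio_ge0 n k : 0 <= ratio n k.
Proof. by rewrite /weight_ratio ltW// divr_gt0 ?mulr_gt0. Qed.

Lemma ratioC n k : ratio n k = ratio k n.
Proof.
by rewrite /weight_ratio addnC; congr (_ / _); ring.
Qed.

Lemma wabs_zmul n f k :
  wt (zmul n f) (n + k)%N = ratio n k * (beta n * wt f k).
Proof.
rewrite /wabs coef_zmul_add normcM normcR ger0_norm; last first.
  by rewrite ltW// divr_gt0 ?mulr_gt0.
by rewrite /weight_ratio; field; rewrite !gt_eqF.
Qed.

Lemma wabs_zmul_lt n f m : (m < n)%N -> wt (zmul n f) m = 0.
Proof. by move=> mn; rewrite /wabs coef_zmul_lt// normc0 mul0r. Qed.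

Lemma enorm_zmul_le n f (c : R) : 0 <= c ->
  (forall k, f k != 0 -> ratio n k <= c) ->
  enorm (zmul n f) <= c * beta n * enorm f.
Proof.
move=> c0 hc.
have bn := ltW (beta_gt0 n).
have cb : 0 <= c * beta n by rewrite mulr_ge0.
apply: enorm_le => [|D]; first by rewrite mulr_ge0// enorm_ge0.
apply: (@le_trans _ _ (\sum_(m < n + D) wt (zmul n f) m `^ p)).
  by rewrite addnC big_split_ord/= lerDl sumr_ge0// => i _; exact: powR_ge0.
rewrite big_split_ord/= big1 ?add0r; last first.
  by move=> i _; rewrite wabs_zmul_lt// powR0 ?gt_eqF.
rewrite powRM ?enorm_ge0//.
apply: le_trans (ler_wpM2l (powR_ge0 _ _) (sum_wabs_le_enorm f D)).
rewrite mulr_sumr; apply: ler_sum => k _.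
rewrite -powRM ?wabs_ge0// wabs_zmul -mulrA.
have wf := @wabs_ge0 _ _ beta_gt0 f k.
apply: ge0_ler_powR; rewrite ?nnegrE ?(ltW p_gt0)//.
- exact: mulr_ge0 (ratio_ge0 n k) (mulr_ge0 bn wf).
- exact: mulr_ge0 c0 (mulr_ge0 bn wf).
have [fk|fk] := eqVneq (f k) 0; first by rewrite /wabs fk normc0 mul0r !mulr0.
by rewrite ler_wpM2r ?hc// mulr_ge0.
Qed.

(** * Contraction on series of high order *)

(** The sum is the product of r with the truncation of u at order D; truncating
    makes it a finite combination of orbit vectors of r. *)
Definition halves_high_order (N : nat) :=
  forall r, (forall k, (k <= N)%N -> r k = 0) ->
  exists M, forall u, (forall n, (n < M)%N -> u n = 0) -> forall D,
    enorm (\sum_(n < D) u n *: zmul n r) <= 2^-1 * enorm u.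

(** In l^1 a bound on the norms of the z^n r relative to those of the z^n is a
    bound on the norm of multiplication by r. *)
Lemma halves_high_order_l1 N : p = 1 ->
  (forall e : R, 0 < e -> exists M, forall n k, (M <= n)%N -> (N < k)%N ->
     ratio n k <= e) ->
  halves_high_order N.
Proof.
move=> p1 small r rN.
have r1 : 0 < 2 * (1 + enorm r).
  by rewrite mulr_gt0// ltr_wpDr// enorm_ge0.
have [|M hM] := small (2 * (1 + enorm r))^-1; first by rewrite invr_gt0.
exists M => u uM D; apply: le_trans (enorm_sumZ D u (fun n => zmul n r)) _.
apply: (@le_trans _ _ (\sum_(n < D) wt u n * 2^-1)); last first.
  rewrite -mulr_suml mulrC ler_wpM2l ?invr_ge0//.
  have := sum_wabs_le_enorm u D.
  have powp (x : R) : 0 <= x -> x `^ p = x by rewrite p1; exact: powRr1.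
  rewrite powp ?enorm_ge0//; apply: le_trans.
  by apply: ler_sum => i _; rewrite powp// wabs_ge0.
apply: ler_sum => n _.
have [un|un] := eqVneq (u n) 0; first by rewrite /wabs un normc0 !mul0r.
have Mn : (M <= n)%N.
  by rewrite leqNgt; apply/negP => /uM/eqP; rewrite (negPf un).
rewrite /wabs -mulrA ler_wpM2l ?normc_nonneg//.
apply: le_trans (enorm_zmul_le n r (2 * (1 + enorm r))^-1 _ _) _.
- by rewrite invr_ge0 ltW.
- move=> k rk; apply: hM => //; rewrite ltnNge; apply/negP => /rN/eqP.
  by rewrite (negPf rk).
rewrite mulrAC mulrC ler_wpM2l ?(ltW (beta_gt0 _))//.
rewrite ler_pdivrMl// mulrAC divff//.
by rewrite mul1r lerDr.
Qed.

Lemma wabs_sum_zmul_le D u r m :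
  wt (\sum_(n < D) u n *: zmul n r) m <=
    \sum_(n < m.+1) (wt u n * wt r (m - n)%N) * ratio n (m - n)%N.
Proof.
pose t n := if (n <= m)%N then
  wt u n * wt r (m - n)%N * ratio n (m - n)%N else 0 : R.
have t0 n : 0 <= t n.
  rewrite /t; case: ifP => // _; apply: mulr_ge0 (ratio_ge0 _ _).
  by apply: mulr_ge0; exact: wabs_ge0.
rewrite [leRHS](_ : _ = \sum_(n < m.+1) t n); last first.
  by apply: eq_bigr => n _; rewrite /t -ltnS ltn_ord.
apply: le_trans (sum_ord_le_support t D m t0 _); last first.
  by move=> i; rewrite /t ltnNge => /negPf ->.
rewrite /wabs coef_sum.
apply: (@le_trans _ _ (\sum_(n < D) normc ((u n *: zmul n r) m) * beta m)).
  rewrite -mulr_suml ler_wpM2r ?(ltW (beta_gt0 _))//.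
  elim/big_ind2: _ => [|a b c d ab cd|i _]; rewrite ?normc0//.
  by apply: le_trans (normc_triangle _ _) _; exact: lerD.
apply: ler_sum => n _; rewrite coefZ normcM -mulrA -/(wt (zmul n r) m) /t.
case: (zmul_indexP n m) => [l ln|k].
  by rewrite wabs_zmul_lt// leqNgt ln mulr0.
rewrite wabs_zmul leq_addr addKn /wabs.
by rewrite le_eqVlt; apply/orP; left; apply/eqP; ring.
Qed.

(** In terms of weighted absolute values, the m-th coefficient of the product is
    a sum of |u n| |r (m - n)| against the ratios.  Hoelder's inequality bounds
    its p-th power by C^p times the m-th coefficient of the Cauchy product of
    the sequences of p-th powers, whose total mass is at most
    (|r| |u|)^p. *)
Lemma enorm_conv_le (q C : R) : 0 < q -> p^-1 + q^-1 = 1 -> 0 < C ->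
  (forall n, \sum_(k < n.+1) ratio k (n - k)%N `^ q <= C `^ q) ->
  forall r u D,
    enorm (\sum_(n < D) u n *: zmul n r) <= C * enorm r * enorm u.
Proof.
move=> q0 pq C0 hC r u D.
have w0 f n : 0 <= wt f n :> R by exact: wabs_ge0.
apply: enorm_le => [|K].
  by rewrite !mulr_ge0 ?enorm_ge0 ?(ltW C0).
pose U n := wt u n `^ p : R; pose V n := wt r n `^ p : R.
apply: (@le_trans _ _
  (\sum_(m < K) C `^ p * \sum_(n < m.+1) U n * V (m - n)%N)).
  apply: ler_sum => m _.
  set S := \sum_(n < m.+1) _.
  have S0 : 0 <= S by apply: sumr_ge0 => i _; rewrite mulr_ge0 ?powR_ge0.
  have -> : C `^ p * S = (S `^ p^-1 * C) `^ p.
    rewrite powRM ?powR_ge0 ?(ltW C0)// -powRrM mulVf ?gt_eqF// powRr1//.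
    exact: mulrC.
  apply: ge0_ler_powR; rewrite ?nnegrE ?(ltW p_gt0)//.
    by rewrite mulr_ge0 ?powR_ge0 ?(ltW C0).
  apply: le_trans (wabs_sum_zmul_le D u r m) _.
  apply: (@hoelder_sum_le _ p q _ _ m.+1
    (fun n => wt u n * wt r (m - n)%N) (fun n => ratio n (m - n)%N)) => //.
  - exact: powR_ge0.
  - by move=> i; rewrite mulr_ge0.
  - by move=> i; exact: ratio_ge0.
  rewrite -powRrM mulVf ?gt_eqF// powRr1//.
  by apply: ler_sum => i _; rewrite powRM.
rewrite -mulr_sumr -mulrA powRM ?mulr_ge0 ?enorm_ge0 ?(ltW C0)//.
rewrite ler_wpM2l ?powR_ge0//.
apply: le_trans (sum_convolution_le U V K _ _) _.
- by move=> i; exact: powR_ge0.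
- by move=> i; exact: powR_ge0.
rewrite powRM ?enorm_ge0// mulrC.
apply: ler_pM; rewrite ?sumr_ge0 ?sum_wabs_le_enorm// => i _; exact: powR_ge0.
Qed.

(** A quarter of the norm is allotted to the tail of r and a quarter to its
    truncation.  The product of the truncations of u and r is read by
    commutativity as a combination of finitely many powers of z applied to u,
    each of which is small on series of high order. *)
Lemma halves_high_order_lp (C : R) : 0 < C ->
  (forall r u D,
     enorm (\sum_(n < D) u n *: zmul n r) <= C * enorm r * enorm u) ->
  (forall k, (1 <= k)%N -> forall e : R, 0 < e ->
     exists M, forall n, (M <= n)%N -> ratio n k <= e) ->
  halves_high_order 0.
Proof.
move=> C0 hC small r r0.
have unif J (d : R) : 0 < d ->
    exists M, forall k n, (0 < k < J)%N -> (M <= n)%N -> ratio n k <= d.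
  move=> d0; elim: J => [|J [M1 h1]].
    by exists 0%N => k n; rewrite ltn0 andbF.
  have [->|J0] := eqVneq J 0%N.
    by exists 0%N => k n; rewrite ltnS leqn0; case: k.
  have [|M2 h2] := small J _ d d0; first by rewrite lt0n.
  exists (maxn M1 M2) => k n /andP[k0]; rewrite geq_max ltnS leq_eqVlt.
  move=> /predU1P[->|kJ] /andP[n1 n2]; first exact: h2.
  by apply: h1 => //; rewrite k0.
have [|K hK] := trunc_approx r (4^-1 / C); first by rewrite divr_gt0.
pose S := \sum_(k < K) normc (r k) * beta k.
have S0 : 0 <= S by apply: sumr_ge0 => i _; exact: wabs_ge0.
have [e e0 Se] : exists2 e, 0 < e & S * e <= 4^-1.
  exists (4 * (1 + S))^-1; first by rewrite invr_gt0 mulr_gt0// ltr_wpDr.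
  rewrite ler_pdivrMr ?mulr_gt0 ?ltr_wpDr// mulrA mulVf// mul1r.
  by rewrite lerDr.
have [M hM] := unif K e e0.
exists M => u uM D.
have -> : \sum_(n < D) u n *: zmul n r =
    \sum_(n < D) u n *: zmul n (r - trunc K r) +
    \sum_(k < K) r k *: zmul k (trunc D u).
  have -> : \sum_(k < K) r k *: zmul k (trunc D u) =
      \sum_(n < D) u n *: zmul n (trunc K r).
    rewrite /trunc.
    under eq_bigr do rewrite zmul_sumZ scaler_sumr.
    under [RHS]eq_bigr do rewrite zmul_sumZ scaler_sumr.
    rewrite exchange_big/=; apply: eq_bigr => n _; apply: eq_bigr => k _.
    by rewrite zmul_monoC [LHS]scalerA [RHS]scalerA mulrC.
  rewrite -big_split/=; apply: eq_bigr => n _.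
  by rewrite -scalerDr -zmulD subrK.
apply: le_trans (enormD _ _) _.
have -> : 2^-1 * enorm u = 4^-1 * enorm u + 4^-1 * enorm u by field.
apply: lerD.
  apply: le_trans (hC _ _ _) _; rewrite ler_wpM2r ?enorm_ge0//.
  by rewrite mulrC -ler_pdivlMr.
apply: le_trans (enorm_sumZ K r (fun k => zmul k (trunc D u))) _.
apply: (@le_trans _ _ (\sum_(k < K) (normc (r k) * beta k) * (e * enorm u))).
  apply: ler_sum => k _.
  have [rk|rk] := eqVneq (r k) 0; first by rewrite rk normc0 !mul0r.
  rewrite -mulrA ler_wpM2l ?normc_nonneg//.
  apply: le_trans (enorm_zmul_le k (trunc D u) e _ _) _.
  - exact: ltW.
  - move=> n; rewrite coef_trunc; case: ifPn => nD; last by rewrite eqxx.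
    move=> un; rewrite ratioC; apply: hM.
      rewrite ltn_ord andbT lt0n; apply/negP => /eqP k0.
      by rewrite k0 r0 ?eqxx in rk.
    by rewrite leqNgt; apply/negP => /uM/eqP; rewrite (negPf un).
  have scale (a b c d : R) :
      0 <= a -> 0 <= b -> c <= d -> a * b * c <= b * (a * d).
    by move=> a0 b0 cd; rewrite -mulrA mulrCA !ler_wpM2l.
  by apply: scale; [exact: ltW|exact: ltW|exact: enorm_trunc].
rewrite -mulr_suml mulrA; apply: ler_wpM2r Se; exact: enorm_ge0.
Qed.

End WeightedShift.

(** * Spans of orbits *)

Section LinearSpan.
Context {K : numFieldType} {V : lmodType K}.
Implicit Types (S : set V) (v w : V).

Lemma lin_span_sub S v : S v -> lin_span S v.
Proof.
move=> Sv; exists 1%N, (fun=> 1), (fun=> v); split=> //.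
by rewrite big_ord1 scale1r.
Qed.

Lemma lin_spanZ S (a : K) v : lin_span S v -> lin_span S (a *: v).
Proof.
move=> [n [c [s [Ss ->]]]]; exists n, (fun i => a * c i), s; split=> //.
by rewrite scaler_sumr; apply: eq_bigr => i _; rewrite scalerA.
Qed.

Lemma lin_spanD S v w : lin_span S v -> lin_span S w -> lin_span S (v + w).
Proof.
move=> [m [c [s [Ss ->]]]] [n [d [t [St ->]]]].
pose glue X (x : 'I_m -> X) (y : 'I_n -> X) (i : 'I_(m + n)) : X :=
  match fintype.split i with inl j => x j | inr k => y k end.
exists (m + n)%N, (glue _ c d), (glue _ s t); split=> [i|].
  by rewrite /glue; case: fintype.split.
rewrite big_split_ord /glue; congr (_ + _); apply: eq_bigr => i _.
  by rewrite -/(unsplit (inl i)) unsplitK.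
by rewrite -/(unsplit (inr i)) unsplitK.
Qed.

Lemma lin_span_iter (A : {linear V -> V}) v w n :
  lin_span (range (fun k => iter k A v)) w ->
  lin_span (range (fun k => iter k A v)) (iter n A w).
Proof.
elim: n => // n IH /IH {IH}; rewrite iterS.
move: (iter n A w) => {}w [m [c [s [Ss ->]]]].
exists m, c, (fun i => A (s i)); split=> [i|].
  by have [k _ <-] := Ss i; exists k.+1.
by rewrite raddf_sum; apply: eq_bigr => i _; rewrite /= linearZ.
Qed.

End LinearSpan.

(** * Contraction from the standing assumption *)

Section StandingAssumption.
Context {R : realType} {p : R} {beta delta : nat -> R}.
Context {p_ge1 : 1 <= p} {beta_gt0 : forall n, 0 < beta n}.
Local Notation L := (ell p_ge1 beta_gt0).
Context {A : {linear L -> L}}.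
Hypothesis delta_gt0 : forall n, 0 < delta n.
Hypothesis AE : forall (f : L) n, A f n = mul_z delta f n.
Local Notation ratio := (weight_ratio beta delta).

Let p_gt0 : 0 < p. Proof. exact: lt_le_trans p_ge1. Qed.

Lemma ratio_small_l1 N :
  (\esum_(x in [set x : nat * nat | (N.+1 <= x.1)%N /\ (N.+1 <= x.2)%N])
     (ratio x.1 x.2)%:E < +oo)%E ->
  forall e : R, 0 < e -> exists M, forall n k, (M <= n)%N -> (N < k)%N ->
    ratio n k <= e.
Proof.
move=> Soo e e0.
have [|Y /finite_seqP[s Ys] Ye] :=
    esum_fin_small _ (fun x => ratio x.1 x.2) e _ Soo e0.
  by move=> x; exact: (ratio_ge0 (beta_gt0 := beta_gt0)).
exists (N + (\max_(x <- s) x.1)).+1 => n k nM kN.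
apply: (Ye (n, k)) => /=.
  by split=> //; apply: leq_ltn_trans (leq_addr _ _) nM.
rewrite Ys => /= snk; have : (n <= \max_(x <- s) x.1)%N.
  exact: (@leq_bigmax_seq _ s xpredT (fun x => x.1) (n, k)).
by rewrite leqNgt (leq_ltn_trans _ nM)// leq_addl.
Qed.

Lemma ratio_small_lp k : tail_bound beta delta ^~ k @ \oo --> 0%E ->
  forall e : R, 0 < e -> exists M, forall n, (M <= n)%N -> ratio n k <= e.
Proof.
move=> tb0 e e0; have [M hM] := cvge0_le _ _ tb0 e0.
exists M.+1 => n Mn; rewrite -lee_fin; apply: le_trans hM.
by apply: ereal_sup_ubound; exists n.
Qed.

Lemma standing_assumption_small : standing_assumption p beta delta ->
  exists N, @halves_high_order R p beta delta p_ge1 beta_gt0 A N.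
Proof.
move=> [hp h1].
have [p1|pn1] := eqVneq p 1.
  have [N _ Soo] := h1 p1; exists N; apply: halves_high_order_l1 => //.
  exact: ratio_small_l1.
have p1 : 1 < p by rewrite lt_neqAle eq_sym pn1.
have [Soo tb] := hp p1; exists 0%N.
pose q := conj_exponent p.
have q0 : 0 < q by rewrite divr_gt0 ?subr_gt0.
have pq : p^-1 + q^-1 = 1.
  by rewrite /q /conj_exponent; field; rewrite subr_eq0 pn1 gt_eqF.
set S := ereal_sup _ in Soo.
have sumS n : ((\sum_(k < n.+1) ratio k (n - k)%N `^ q)%:E <= S)%E.
  by apply: ereal_sup_ubound; exists n.
have S0 : (0 <= S)%E.
  apply: le_trans (sumS 0%N).
  by rewrite lee_fin sumr_ge0// => i _; exact: powR_ge0.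
have Sfin : S \is a fin_num by rewrite ge0_fin_numE.
(* Adding 1 keeps C positive without a lower bound on the supremum. *)
pose C := (fine S + 1) `^ q^-1.
have C0 : 0 < C by rewrite powR_gt0// ltr_wpDl ?fine_ge0.
apply: (halves_high_order_lp delta_gt0 AE C C0) => [r u D|k k1].
  apply: (enorm_conv_le delta_gt0 AE q C) => // n.
  rewrite /C -powRrM mulVf ?gt_eqF// powRr1 ?addr_ge0 ?fine_ge0//.
  apply: (@le_trans _ _ (fine S)); last by rewrite lerDl.
  by rewrite -lee_fin fineK.
exact/ratio_small_lp/tb.
Qed.

End StandingAssumption.

(** * Cyclicity *)

Section Cyclicity.
Context {R : realType} {p : R} {beta delta : nat -> R}.
Context {p_ge1 : 1 <= p} {beta_gt0 : forall n, 0 < beta n}.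
Local Notation L := (ell p_ge1 beta_gt0).
Context {A : {linear L -> L}}.
Hypothesis delta_gt0 : forall n, 0 < delta n.
Hypothesis delta0 : delta 0%N = 1.
Hypothesis AE : forall (f : L) n, A f n = mul_z delta f n.
Implicit Types (f g u r F : L).
Local Notation enorm := (@enorm R p beta p_ge1 beta_gt0).
Local Notation mono := (@mono R p beta p_ge1 beta_gt0).
Local Notation zmul := (@zmul R p beta delta p_ge1 beta_gt0 A).
Local Notation orbit_span f := (lin_span (range (fun n : nat => iter n A f))).

Lemma orbit_span_zmul f F n : orbit_span f F -> orbit_span f (zmul n F).
Proof. by move=> fF; exact/lin_spanZ/lin_span_iter. Qed.

Lemma coef_zmul_diag n f : zmul n f n = f 0%N.
Proof.
have := coef_zmul_add delta_gt0 AE n f 0; rewrite addn0 => ->.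
by rewrite delta0 mulr1 divff ?gt_eqF// mul1r.
Qed.

Lemma zmul_mono0 n : zmul n (mono 0) = mono n.
Proof.
apply: ell_eqP => m; case: (zmul_indexP n m) => [{}m mn|k].
  by rewrite coef_zmul_lt// coef_mono ltn_eqF.
have nkn : (n + k == n)%N = (k == 0)%N by rewrite -{2}[n]addn0 eqn_add2l.
rewrite coef_zmul_add// !coef_mono nkn.
case: eqP => [->|_]; last by rewrite mulr0.
by rewrite addn0 delta0 mulr1 divff ?gt_eqF// mulr1.
Qed.

(** Triangular elimination: when F 0 = 1, the series z^n F starts with z^n, so
    subtracting F n * z^n F cancels the coefficient at n and leaves the earlier
    ones alone. *)
Lemma orbit_span_normalized f N : f 0%N != 0 ->
  exists F, [/\ orbit_span f F, F 0%N = 1 &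
    forall k, (0 < k <= N)%N -> F k = 0].
Proof.
move=> f0; elim: N => [|N [F [fF F0 FN]]].
  exists ((f 0%N)^-1 *: f); split.
  - by apply/lin_spanZ/lin_span_sub; exists 0%N.
  - by rewrite coefZ mulVf.
  - by case.
exists (F - F N.+1 *: zmul N.+1 F); split.
- rewrite -scaleN1r; apply: lin_spanD => //.
  by apply/lin_spanZ/lin_spanZ/orbit_span_zmul.
- by rewrite coefB coefZ coef_zmul_lt// mulr0 subr0.
move=> k /andP[k0]; rewrite leq_eqVlt coefB coefZ => /predU1P[->|kN].
  by rewrite coef_zmul_diag F0 mulr1 subrr.
by rewrite coef_zmul_lt// mulr0 subr0 FN// k0.
Qed.

Section Approximation.
Variables (V : set L) (F : L) (M : nat).
Hypothesis V_linear : forall (a : R[i]) v w, V v -> V w -> V (a *: v + w).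
Hypothesis V_zmul : forall n, V (zmul n F).
Hypothesis F0 : F 0%N = 1.
Hypothesis small : forall u, (forall n, (n < M)%N -> u n = 0) -> forall D,
  enorm (\sum_(n < D) u n *: zmul n (F - mono 0)) <= 2^-1 * enorm u.

Definition approximable u :=
  forall e : R, 0 < e -> exists2 v, V v & enorm (u - v) < e.

Let V0 : V 0.
Proof. by rewrite -(addNr (zmul 0 F)) -scaleN1r; exact: V_linear. Qed.

(** The correction v is the product of F with a truncation of u.  Then u - v is
    the truncation error of u, made at most a quarter of its norm, minus
    the product of the truncation with F - 1. *)
Lemma approx_step u : (forall n, (n < M)%N -> u n = 0) ->
  exists v, [/\ V v, forall n, (n < M)%N -> (u - v) n = 0 &
    enorm (u - v) <= 3 / 4 * enorm u].
Proof.
move=> uM; have [u0|un0] := eqVneq (enorm u) 0.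
  exists 0; rewrite subr0 u0 mulr0; split=> //; exact: V0.
have u0 : 0 < enorm u by rewrite lt_neqAle eq_sym un0 enorm_ge0.
have [|D hD] := trunc_approx u (4^-1 * enorm u); first by rewrite mulr_gt0.
exists (\sum_(n < D) u n *: zmul n F); split.
- elim: D {hD} => [|D IH]; first by rewrite big_ord0; exact: V0.
  by rewrite big_ord_recr/= addrC; exact: V_linear.
- move=> m mM; rewrite coefB uM// coef_sum big1 ?subrr// => i _.
  rewrite coefZ; have [iM|Mi] := ltnP i M; first by rewrite uM// mul0r.
  by rewrite coef_zmul_lt ?mulr0// (leq_trans mM).
have -> : u - \sum_(n < D) u n *: zmul n F =
    (u - trunc D u) - \sum_(n < D) u n *: zmul n (F - mono 0).
  rewrite -addrA -opprD; congr (_ - _).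
  rewrite /trunc -big_split/=; apply: eq_bigr => n _.
  rewrite -scalerDr -zmul_mono0 -zmulD//; congr (_ *: zmul _ _).
  by rewrite addrC subrK.
apply: le_trans (enormB _ _) _.
have -> : 3 / 4 * enorm u = 4^-1 * enorm u + 2^-1 * enorm u by field.
by apply: lerD => //; exact: small.
Qed.

Lemma approximable_tail u : (forall n, (n < M)%N -> u n = 0) -> approximable u.
Proof.
move=> uM e e0.
have chain (c x y a z : R) :
    0 <= c -> x <= c * y -> y <= a * z -> x <= c * a * z.
  by move=> c0 xy yz; rewrite (le_trans xy)// -mulrA ler_wpM2l.
have iterated j : exists v, [/\ V v, forall n, (n < M)%N -> (u - v) n = 0 &
    enorm (u - v) <= (3 / 4) ^+ j * enorm u].
  elim: j => [|j [v [Vv vM hv]]].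
    by exists 0; rewrite subr0 expr0 mul1r; split=> //; exact: V0.
  have [w [Vw wM hw]] := approx_step _ vM.
  have uvw : u - (v + w) = u - v - w by rewrite opprD addrA.
  exists (v + w); rewrite uvw; split; [|exact: wM|].
    by rewrite -[v]scale1r; exact: V_linear.
  rewrite exprS; apply: chain hw hv.
  by rewrite divr_ge0.
have c0 : 0 < e / (1 + enorm u) by rewrite divr_gt0// ltr_wpDr// enorm_ge0.
have /cvgrPdist_lt/(_ _ c0) : (3 / 4 : R) ^+ j @[j --> \oo] --> 0.
  by apply: cvg_expr; rewrite ger0_norm//; lra.
move=> [j _ /(_ j (leqnn j))] /=.
rewrite sub0r normrN ger0_norm ?exprn_ge0// => hj.
have [v [Vv _ hv]] := iterated j; exists v => //; apply: le_lt_trans hv _.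
move: hj; rewrite ltr_pdivlMr ?ltr_wpDr ?enorm_ge0//; apply: le_lt_trans.
by rewrite ler_wpM2l ?exprn_ge0// lerDr.
Qed.

(** Series of order m are spanned by z^m F and the series of order m + 1, so the
    order of vanishing can be lowered from M to 0 one unit at a time. *)
Lemma approximable_all u : approximable u.
Proof.
suff H k : (k <= M)%N -> forall u, (forall n, (n < M - k)%N -> u n = 0) ->
    approximable u.
  by apply: (H M) => // n; rewrite subnn.
elim: k => [|k IH] kM {}u uk.
  by apply: approximable_tail => n; rewrite -{1}(subn0 M); exact: uk.
move=> e e0; set m := (M - k.+1)%N in uk.
have [n|v Vv hv] := IH (ltnW kM) (u - u m *: zmul m F) _ e e0.
  rewrite -(subnSK kM) -/m ltnS leq_eqVlt coefB coefZ => /predU1P[->|nm].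
    by rewrite coef_zmul_diag F0 mulr1 subrr.
  by rewrite coef_zmul_lt// mulr0 subr0 uk.
exists (u m *: zmul m F + v); first exact: V_linear.
by rewrite opprD addrA.
Qed.

End Approximation.

End Cyclicity.

Lemma closure_ellP {R : realType} {p : R} {beta : nat -> R} {p_ge1 : 1 <= p}
    {beta_gt0 : forall n, 0 < beta n} (V : set (ell p_ge1 beta_gt0))
    (u : ell p_ge1 beta_gt0) :
  closure V u <-> approximable V u.
Proof.
have ballE v (e : R) : ball u e%:C v = (enorm (u - v) < e) :> Prop.
  by rewrite -ball_normE /= ell_normrE ltcR.
split=> [clV e e0|Vu B /nbhs_ballP[e /= e0 eB]].
  have [|v [Vv]] := clV (ball u e%:C).
    by apply: nbhsx_ballx; rewrite ltcR.
  by rewrite ballE => ve; exists v.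
(* A positive radius in R[i] is a positive real number. *)
move: e0 eB; case: e => e i; rewrite ltcE /= => /andP[/eqP -> e0] eB.
have [v Vv ve] := Vu e e0; exists v; split=> //; apply: eB.
by rewrite -[_ +i* _]/(e%:C) ballE.
Qed.

Theorem corollary2p7 (R : realType) (p : R) (beta delta : nat -> R)
    (p_ge1 : 1 <= p)
    (beta_gt0 : forall n : nat, 0 < beta n)
    (delta_gt0 : forall n : nat, 0 < delta n)
    (beta0 : beta 0%N = 1) (delta0 : delta 0%N = 1)
    (delta_beta : standing_assumption p beta delta)
    (mul_z_ell1 : p = 1 -> forall g : nat -> R[i],
       g \in in_ell p beta -> mul_z delta g \in in_ell p beta)
    (f : ell p_ge1 beta_gt0) :
  cyclic_vector (mul_z_op p_ge1 beta_gt0 delta_gt0 delta_beta mul_z_ell1) f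
  <-> f 0%N <> 0.
Proof.
set A : {linear _ -> _} := mul_z_op _ _ _ _ _.
have AE g n : A g n = mul_z delta g n by [].
rewrite /cyclic_vector; set V := lin_span _; split=> [clV f0|/eqP f0].
  have : closure V (mono 0) by rewrite clV.
  move=> /closure_ellP/(_ (beta 0%N) (beta_gt0 0%N))[v Vv].
  suff v0 : v 0%N = 0.
    apply/negP; rewrite -leNgt; apply: le_trans (wabs_le_enorm _ 0%N).
    by rewrite /wabs coefB v0 subr0 coef_mono normc1 mul1r.
  have [n [c [s [Vs ->]]]] := Vv.
  rewrite coef_sum big1// => i _; rewrite coefZ; have [k _ <-] := Vs i.
  by case: k => [|k]; rewrite ?iterS ?AE ?mul_z0 /= ?f0 mulr0.
have [N small] := standing_assumption_small delta_gt0 AE delta_beta.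
have [F [VF F0 FN]] := orbit_span_normalized delta_gt0 delta0 AE f N f0.
have [|M hM] := small (F - mono 0).
  move=> [|k] kN; rewrite coefB coef_mono; first by rewrite F0 subrr.
  by rewrite FN// subr0.
apply/seteqP; split=> // u _; apply/closure_ellP.
apply: (approximable_all delta_gt0 delta0 AE V F M) => //.
  by move=> a v w Vv Vw; apply: lin_spanD => //; exact: lin_spanZ.
by move=> n; exact: orbit_span_zmul.
Qed.
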